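(* Let $X$ be an infinite regular cardinal and let $\mathscr{U}$ be the clone of all almost unary functions on $X$. Let $\mathscr{C}$ be a clone over $X$ with $\mathscr{C}\supsetneq\mathscr{U}$. Then there exists $n\geq 2$ such that $\mathscr{C}=\mathscr{M}_n$, where $\mathscr{M}_n=\langle\{m_2^n\}\cup T_1\rangle$.
   Context: $X$ is an infinite regular cardinal with its usual well-order. $\mathscr{O}^{(n)}$ is the set of all functions $X^n\to X$ and $\mathscr{O}=\bigcup_{n\ge 1}\mathscr{O}^{(n)}$. A clone over $X$ is a subset of $\mathscr{O}$ containing all projections and closed under composition. For $\mathscr{F}\subseteq\mathscr{O}$, $\langle\mathscr{F}\rangle$ is the smallest clone containing $\mathscr{F}$. A function $f\in\mathscr{O}^{(n)}$ is almost unary iff there are $F\in\mathscr{O}^{(1)}$ and $1\le k\le n$ with $f(x_1,\dots,x_n)<F(x_k)$ for all $(x_1,\dots,x_n)\in X^n$. $\mathscr{U}$ is the set of all almost unary functions (it is a clone), and $T_1$ is the set of all binary almost unary functions. For $1\le k\le n$, $m^n_k\in\mathscr{O}^{(n)}$ is defined by $m^n_k(x_1,\dots,x_n)=x_{j_k}$ if $x_{j_1}\le\dots\le x_{j_n}$ with $\{j_1,\dots,j_n\}=\{1,\dots,n\}$ (the $k$-th smallest entry). *)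

(* Defs.v *)
From mathcomp Require Import all_boot all_order.
From mathcomp Require Import fingroup perm.
From mathcomp Require Import boolp classical_sets functions cardinality wochoice.

Set Implicit Arguments.
Unset Strict Implicit.
Unset Printing Implicit Defensive.

Import Order.TTheory.
Local Open Scope classical_set_scope.
Local Open Scope card_scope.
Local Open Scope order_scope.

Section Regular.
Context {d : Order.disp_t} (X : orderType d).

Definition cofinal (A : set X) : Prop := forall x, exists2 y, A y & x <= y.

(* The order type of X is an infinite regular cardinal: an infinite initial
   ordinal (no proper initial segment is as large as X) that equals its own
   cofinality (no cofinal subset is smaller than X). *)
Definition infinite_regular_cardinal : Prop :=
  [/\ well_order (<=%O : rel X),
      infinite_set [set: X],
      forall x : X, ~ ([set: X] #<= [set y | y < x])
    & forall A : set X, cofinal A -> A #= [set: X]].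

End Regular.

Section Clones.
Variable X : Type.

Definition op (n : nat) : Type := ('I_n -> X) -> X.

(* Operations of all arities, including nullary ones; the latter are excluded
   from clones by the first clause of [is_clone]. *)
Definition operation : Type := {n : nat & op n}.

Definition mkop (n : nat) (f : op n) : operation := existT op n f.

Definition projection (n : nat) (i : 'I_n) : op n := fun x => x i.

Definition compose (n m : nat) (f : op n) (g : 'I_n -> op m) : op m :=
  fun x => f (fun i => g i x).

Definition is_clone (C : set operation) : Prop :=
  [/\ forall n (f : op n), C (mkop f) -> (0 < n)%N,
      forall n (i : 'I_n), C (mkop (projection i))
    & forall n m (f : op n) (g : 'I_n -> op m),
        C (mkop f) -> (forall i, C (mkop (g i))) -> C (mkop (compose f g))].

Definition generated_clone (F : set operation) : set operation :=
  smallest is_clone F.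

End Clones.

Section AlmostUnary.
Context {d : Order.disp_t} (X : orderType d).

(* Unary operations are taken as functions X -> X. No nullary f qualifies. *)
Definition almost_unary (n : nat) (f : op X n) : Prop :=
  exists (F : X -> X) (k : 'I_n), forall x : 'I_n -> X, f x < F (x k).

Definition almost_unary_clone : set (operation X) :=
  [set f | almost_unary (projT2 f)].

Definition binary_almost_unary : set (operation X) :=
  [set mkop f | f in @almost_unary 2].

(* k counts from 0: [order_stat k] is the (k+1)-th smallest entry. The default
   value of nth is irrelevant, since k is a valid index. *)
Definition order_stat (n : nat) (k : 'I_n) : op X n :=
  fun x => nth (x k) (sort <=%O (codom x)) k.

Lemma order_statE (n : nat) (k : 'I_n) (x : 'I_n -> X) (j : {perm 'I_n}) :
  {homo (x \o j) : a b / (a <= b)%N >-> a <= b} -> order_stat k x = x (j k).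
Proof.
move=> jP; rewrite /order_stat.
have -> : sort <=%O (codom x) = codom (x \o j).
  apply: (@le_sorted_eq _ X); first exact/sort_sorted/le_total.
    apply/(sortedP (x k)) => i; rewrite size_codom card_ord => lti.
    have lti' := ltnW lti.
    have nthE (l : nat) (ltl : (l < n)%N) :
        nth (x k) (codom (x \o j)) l = (x \o j) (Ordinal ltl).
      rewrite /codom /image_mem (nth_map k) ?size_enum_ord //.
      by congr (_ _); apply/val_inj; rewrite /= nth_enum_ord.
    by rewrite !nthE; apply: jP => /=.
  rewrite perm_sort !codomE (map_comp x j) perm_map //.
  apply: uniq_perm; [exact: enum_uniq| |].
    by rewrite map_inj_uniq; [exact: enum_uniq|exact: perm_inj].
  move=> i; rewrite mem_enum; symmetry; apply/mapP.
  by exists ((j^-1)%g i); rewrite ?mem_enum ?permKV.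
rewrite /codom /image_mem (nth_map k) ?size_enum_ord //=.
by congr (x (j _)); apply/val_inj; rewrite /= nth_enum_ord.
Qed.

Definition clone_M (n : nat) (n_ge2 : (2 <= n)%N) : set (operation X) :=
  generated_clone ([set mkop (order_stat (Ordinal n_ge2))] `|` binary_almost_unary).

End AlmostUnary.

Arguments almost_unary_clone {d} X.
Arguments clone_M {d} X {n} n_ge2.

(* Main.v *)
(* Say that f is unbounded along a set B of variables if f is unbounded while
   the variables outside B stay below some constant. By regularity f is never
   unbounded along the empty set, and f is almost unary as soon as the sets
   along which it is unbounded have a common element. Let n be the least number
   of sets with empty intersection along which some member of C is unbounded.
   Given such f and B_1, ..., B_n, substitute for x_i an almost unary function
   controlled by a y_j with i outside B_j: whichever entry of y is smallest, the
   others allow f to be driven above the second smallest entry m of y, and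
   everything below a function of a member of a clone above U belongs to that
   clone. Conversely, if any n - 1 of the sets along which g is unbounded
   intersect, the Baker-Pixley argument builds from m^n_2 a function q with
   q(x) >= min x_B for each such B, and then g(x) is bounded in terms of q(x).
   Finally T_1 generates U: a tuple can be coded by composing binary almost unary
   functions if its entries are taken in increasing order. *)
Require Import Defs.
From mathcomp Require Import all_boot all_order.
From mathcomp Require Import fingroup perm.
From mathcomp Require Import boolp classical_sets functions cardinality wochoice.
Local Open Scope classical_set_scope.

Set Implicit Arguments.
Unset Strict Implicit.
Unset Printing Implicit Defensive.

Import Order.TTheory.

(** * Bounds, recursion and pairing on an infinite regular cardinal *)

Section RegularCardinal.
Local Open Scope order_scope.
Context {d : Order.disp_t} (X : orderType d).
Hypothesis hX : infinite_regular_cardinal X.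

Lemma exists_gt (x : X) : exists y, x < y.
Proof.
have [_ Xinf _ cofX] := hX; apply: contrapT => /forallNP maxx; apply: Xinf.
have cofx : cofinal [set x].
  by move=> y; exists x => //; rewrite leNgt; apply/negP; exact: maxx.
by rewrite -(eq_finite_set (cofX _ cofx)); exact: finite_set1.
Qed.

Lemma exists_bottom : exists x0 : X, forall x, x0 <= x.
Proof.
have [woX /infinite_setN0[x1 _] _ _] := hX.
have [|x0 [[_ lbx0] _]] := woX predT; first by exists x1.
by exists x0 => x; apply: lbx0.
Qed.

Lemma lt_wf : well_founded (fun x y : X => x < y).
Proof.
have [woX _ _ _] := hX => a; apply: contrapT => aN.
pose A : {pred X} := fun x => `[< ~ Acc (fun x y : X => x < y) x >].
have [|z [[/asboolP zN lbz] _]] := woX A; first by exists a; exact/asboolP.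
apply: zN; constructor => y ltyz; apply: contrapT => yN.
have /lbz : y \in A by apply/asboolP.
by rewrite leNgt ltyz.
Qed.

Lemma not_cofinal_bounded (A : set X) : ~ cofinal A -> exists b, forall y, A y -> y < b.
Proof.
move=> /existsNP[b bP]; exists b => y Ay.
by rewrite ltNge; apply/negP => leby; apply: bP; exists y.
Qed.

(** An initial segment is smaller than [X], so by regularity its image is not cofinal. *)
Lemma bounded_image (g : X -> X) (a : X) : exists b, forall y, y <= a -> g y < b.
Proof.
have [_ _ segX cofX] := hX; have [a' lt_aa'] := exists_gt a.
have [/cofX imX|/not_cofinal_bounded[b bP]] := pselect (cofinal (g @` [set y | y < a'])).
  exfalso; apply: (segX a'); move: imX; rewrite card_eq_le => /andP[_ leX].
  exact/(card_le_trans leX)/card_image_le.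
exists b => y leya; apply: bP; exists y => //=; exact: le_lt_trans lt_aa'.
Qed.

Lemma monotone_majorant (g : X -> X) : exists G : X -> X, forall a y, y <= a -> g y < G a.
Proof. by have [G GP] := choice (bounded_image g); exists G. Qed.

Lemma finite_bounded (T : finType) (g : T -> X) : exists b, forall t, g t < b.
Proof.
suff [b bP] : exists b, forall t, t \in enum T -> g t < b.
  by exists b => t; apply: bP; rewrite mem_enum.
elim: (enum T) => [|t s [b bP]].
  by have [x0 _] := exists_bottom; exists x0.
have [b' ltb'] := exists_gt (Order.max b (g t)); exists b' => u.
move: ltb'; rewrite gt_max => /andP[ltbb' ltgb'].
by rewrite inE => /predU1P[-> //|/bP ltub]; exact: lt_trans ltbb'.
Qed.

Lemma finite_majorant (T : finType) (g : T -> X -> X) :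
  exists G : X -> X, forall a t y, y <= a -> g t y < G a.
Proof.
have [G GP] := choice (fun t => monotone_majorant (g t)).
have [H HP] := choice (fun a => finite_bounded (fun t => G t a)).
by exists H => a t y leya; exact: lt_trans (GP t a y leya) (HP a t).
Qed.

Lemma exists_injection_above (b : X) : exists E : X -> X, injective E /\ forall v, b < E v.
Proof.
have [_ _ _ cofX] := hX.
have /cofX : cofinal [set y | b < y].
  move=> x; have [y] := exists_gt (Order.max b x).
  by rewrite gt_max => /andP[ltby ltxy]; exists y => //; exact: ltW.
rewrite card_eq_le => /andP[_ /card_leP[f]].
exists (fun v => set_val (f (to_setT v))); split; last first.
  by move=> v; have := set_valP (f (to_setT v)).
by move=> u v /val_inj /inj; rewrite !in_setT => /(_ isT isT) /(congr1 set_val).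
Qed.

(** Well-founded recursion: at each [x], regularity bounds the values [Phi (M y) y] over the segment
    below [x]. *)
Lemma exists_increasing (Phi : X -> X -> X) :
  exists M : X -> X, forall x y, y < x -> Phi (M y) y < M x.
Proof.
have bnd (x : X) (rec : forall y, y < x -> X) :
    exists b, forall y (ltyx : y < x), Phi (rec y ltyx) y < b.
  pose g y := if pselect (y < x) is left ltyx then Phi (rec y ltyx) y else y.
  have [b bP] := bounded_image g x; exists b => y ltyx.
  have := bP y (ltW ltyx); rewrite /g; case: pselect => // ltyx'.
  by rewrite (Prop_irrelevance ltyx' ltyx).
pose step x (rec : forall y, y < x -> X) := projT1 (cid (bnd x rec)).
exists (Fix lt_wf (fun=> X) step) => x y ltyx.
rewrite [ltRHS]Fix_eq; last first.
  move=> z f g eq_fg; congr (step z _); apply: functional_extensionality_dep => u.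
  by apply: functional_extensionality_dep => p; exact: eq_fg.
rewrite {2}/step; case: cid => b /= bP; exact: bP.
Qed.

(* Pairs with first entry a are coded above a threshold M a that exceeds all
   codes of pairs with smaller first entry; an injection X * X -> X bounded in
   its first argument cannot exist, so only the v below K a are separated. *)
Lemma exists_pairing (K : X -> X) : exists P : X -> X -> X, exists G : X -> X,
  [/\ forall a v, P a v < G a,
      forall a v, exists y, y < P a v
    & forall a a' v v', v <= K a -> v' <= K a' -> P a v = P a' v' -> a = a' /\ v = v'].
Proof.
have [E /all_and2[Einj ltE]] := choice exists_injection_above.
have [B BP] := choice (fun q : X * X => bounded_image (E q.1) (K q.2)).
have [M MP] := exists_increasing (fun b x => B (b, x)).
pose P a v := E (M a) (Order.min v (K a)).
have ltP a v : P a v < B (M a, a) by apply: (BP (M a, a)); rewrite /= ge_min lexx orbT.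
exists P, (fun a => B (M a, a)); split => [//|a v|a a' v v' levK levK' eqP].
  by exists (M a); exact: ltE.
have PN x y u w : x < y -> P x u <> P y w.
  move=> ltxy eqPxy; have := lt_trans (MP y x ltxy) (ltE (M y) (Order.min w (K y))).
  by rewrite -[X in _ < X]eqPxy ltNge ltW //= ltP.
have [lt_aa'|lt_aa'|eqa] := ltgtP a a'.
- by case: (PN _ _ _ _ lt_aa' eqP).
- by case: (PN _ _ _ _ lt_aa' (esym eqP)).
- move: eqP levK; rewrite /P eqa => /Einj.
  by rewrite (min_idPl levK') => + levK; rewrite (min_idPl levK).
Qed.

(** Induction on a list [s] of variables free below [a], the others being frozen at [y]; each new
    variable costs one use of [bounded_image]. *)
Lemma box_bounded (m : nat) (f : op X m) (a : X) :
  exists b, forall x : 'I_m -> X, (forall i, x i <= a) -> f x < b.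
Proof.
have [x0 x0P] := exists_bottom.
suff box (s : seq 'I_m) (y : 'I_m -> X) : exists b, forall x : 'I_m -> X,
    (forall i, i \in s -> x i <= a) -> (forall i, i \notin s -> x i = y i) -> f x < b.
  have [b bP] := box (enum 'I_m) (fun=> x0).
  by exists b => x xa; apply: bP => i; rewrite mem_enum.
elim: s y => [|j s IHs] y.
  have [b ltb] := exists_gt (f y); exists b => x _ xy.
  by rewrite (_ : x = y) //; apply/funext => i; exact: xy.
have [b bP] := choice (fun v => IHs (fun i => if i == j then v else y i)).
have [c cP] := bounded_image b a; exists c => x xa xy.
apply: lt_trans (cP (x j) _); last by apply: xa; rewrite mem_head.
apply: bP => i iNs; first by apply: xa; rewrite inE iNs orbT.
by case: eqVneq => [->//|nij]; apply: xy; rewrite inE negb_or nij.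
Qed.

End RegularCardinal.

Lemma factor_through (T Y Z : Type) (z : Z) (g : T -> Y) (h : T -> Z) :
    (forall x x', g x = g x' -> h x = h x') ->
  exists u : Y -> Z, forall x, h x = u (g x).
Proof.
move=> gh.
have [|u uP] := @choice Y Z (fun a b => forall x, g x = a -> h x = b); last first.
  by exists u => x; exact: uP.
move=> a; have [[x gxa]|/forallNP aN] := pselect (exists x, g x = a).
  by exists (h x) => x' gx'a; apply: gh; rewrite gx'a.
by exists z => x gxa; case: (aN x).
Qed.

(** * Generating all almost unary functions from the binary ones *)

Section GeneratingAlmostUnary.
Local Open Scope order_scope.
Context {d : Order.disp_t} (X : orderType d) (D : set (operation X)).
Hypotheses (hX : infinite_regular_cardinal X) (hD : is_clone D).
Hypothesis hT : @binary_almost_unary d X `<=` D.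

Lemma clone_binary (t : X -> X -> X) (G : X -> X) (m : nat) (g h : op X m) :
    (forall a c, t a c < G a) -> D (mkop g) -> D (mkop h) ->
  D (mkop (fun x => t (g x) (h x))).
Proof.
have [_ _ Dcomp] := hD => tG Dg Dh.
pose w (i : 'I_2) : op X m := if i == ord0 then g else h.
apply: (Dcomp 2 m (fun y => t (y ord0) (y ord_max)) w).
  apply: hT; exists (fun y => t (y ord0) (y ord_max)) => //.
  by exists G, ord0 => y; exact: tG.
by move=> i; rewrite /w; case: ifP.
Qed.

Lemma clone_unary (u : X -> X) (m : nat) (g : op X m) :
  D (mkop g) -> D (mkop (fun x => u (g x))).
Proof.
have [G GP] := choice (fun a => exists_gt hX (u a)).
by move=> Dg; apply: (@clone_binary (fun a _ => u a) G m g g).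
Qed.

(** The bottom [z] marks failure. The code pairs the head entry with the code of the tail; if the
    head entry is the largest, the tail's code stays below [K] of it, where the pairing is
    injective. *)
Lemma exists_coding (z : X) (zP : forall x, z <= x) (m : nat) (s : seq 'I_m) : (0 < m)%N ->
  exists c : op X m, exists G : X -> X,
  [/\ D (mkop c),
      forall x a, (forall j, j \in s -> x j <= a) -> c x < G a,
      forall x x', c x = c x' -> c x <> z -> forall j, j \in s -> x j = x' j
    & forall x, sorted >=%O (map x s) -> c x <> z].
Proof.
move=> m_gt0; elim: s => [|i s [c [K [Dc cK cinj cN]]]].
  have [e ltze] := exists_gt hX z; have [b lteb] := exists_gt hX e.
  exists (fun=> e), (fun=> b); split=> // [|x _ ez]; last by rewrite ez ltxx in ltze.
  by have [_ Dproj _] := hD; exact: (clone_unary (fun=> e) (Dproj m (Ordinal m_gt0))).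
have [P [G [PG ltP Pinj]]] := exists_pairing hX K.
have [G' GG'] := monotone_majorant hX G.
have PN a v : P a v <> z.
  by move=> eqPz; have [y] := ltP a v; rewrite eqPz ltNge zP.
pose t a v := if (v != z) && (v <= K a) then P a v else z.
have tG a v : t a v < G a by rewrite /t; case: ifP => // _; exact: le_lt_trans (PG a v).
exists (fun x => t (x i) (c x)), G'; split.
- by apply: clone_binary tG _ Dc; have [_ Dproj _] := hD; exact: Dproj.
- by move=> x a xa; apply: lt_trans (tG _ _) (GG' _ _ (xa i _)); rewrite mem_head.
- move=> x x'; rewrite /t; case: ifP => // /andP[/eqP cxN leK].
  case: ifP => [/andP[_ leK']|_ /PN//] /Pinj[]// xi cx _ j.
  by rewrite inE => /predU1P[->//|]; exact: cinj.
move=> x /= pathx; rewrite /t ifT //; apply/andP; split.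
  by apply/eqP/cN; exact: path_sorted pathx.
apply/ltW/cK => j js.
have /allP := order_path_min (rev_trans le_trans) pathx.
by apply; exact: map_f.
Qed.

(* By induction on a list L of enumerations of the variables there is g in D
   that determines x k everywhere and determines f x as soon as x decreases
   along some member of L. *)
Lemma almost_unary_generated : almost_unary_clone X `<=` D.
Proof.
case=> m f [F [k /= fF]].
have m_gt0 : (0 < m)%N by apply: leq_ltn_trans (ltn_ord k).
have [z zP] := exists_bottom hX.
have [_ Dproj _] := hD.
have determine (L : seq (seq 'I_m)) : (forall s, s \in L -> forall j, j \in s) ->
  exists g : op X m,
  [/\ D (mkop g),
      forall x x', g x = g x' -> x k = x' k
    & forall x x', g x = g x' ->
      (exists2 s, s \in L & sorted >=%O (map x s)) -> f x = f x'].
  elim: L => [_|s L IHL Lfull].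
    by exists (fun x => x k); split=> // [|x x' _ []//]; exact: Dproj.
  have [u uL|g [Dg gk gf]] := IHL; first by apply: Lfull; rewrite inE uL orbT.
  have sfull : forall j, j \in s by apply: Lfull; rewrite mem_head.
  have [c [_ [Dc _ cinj cN]]] := exists_coding zP s m_gt0.
  have [K FK] : exists K : X -> X, forall x, F (x k) = K (g x).
    by apply: (factor_through z) => x x' /gk ->.
  (* The fallback [F (x k)] lies strictly above [f x]. Since [g] determines [x k], a tuple with a
     failed code cannot share both [g] and [h] with a successfully coded one. *)
  pose h x := if c x == z then F (x k) else f x.
  have [t tP] : exists t : X * X -> X, forall x, h x = t (g x, c x).
    apply: (factor_through z) => x x' [/gk xk cx]; rewrite /h -cx xk.
    case: eqP => // cxN; congr f; apply/funext => j; exact: (cinj x x').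
  have hK x : h x <= K (g x) by rewrite -FK /h; case: ifP => // _; exact: ltW.
  have [P [G [PG _ Pinj]]] := exists_pairing hX K.
  exists (fun x => P (g x) (t (g x, c x))).
  have Pg x x' : P (g x) (t (g x, c x)) = P (g x') (t (g x', c x')) ->
      g x = g x' /\ h x = h x'.
    by rewrite -!tP => /Pinj[].
  split=> [|x x' /Pg[/gk//]|x x' /Pg[gx hx] [u]].
    by apply: (clone_binary (t := fun a v => P a (t (a, v))) (G := G)).
  rewrite inE => /predU1P[->{u}|uL xu]; last by apply: gf => //; exists u.
  move=> /cN cxN; move: hx; rewrite /h; case: eqP => // _; case: eqP => // _ fx.
  by have := fF x; rewrite fx (gk _ _ gx) ltxx.
(* Every tuple decreases along some enumeration, so with all permutations in the list [g x] alone
   determines [f x]. *)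
have [s|g [Dg _ gf]] := determine (permutations (enum 'I_m)).
  by rewrite mem_permutations => /perm_mem + j => ->; rewrite mem_enum.
have [u uP] : exists u : X -> X, forall x, f x = u (g x).
  apply: (factor_through z) => x x' gx; apply: gf => //.
  exists (sort (relpre x >=%O) (enum 'I_m)); first by rewrite mem_permutations perm_sort.
  by rewrite sorted_map; apply: sort_sorted => i j; exact: le_total.
by rewrite (_ : f = fun x => u (g x)); [exact: clone_unary|exact/funext].
Qed.

End GeneratingAlmostUnary.

(** * Closure under domination *)

Section AboveAlmostUnary.
Local Open Scope order_scope.
Context {d : Order.disp_t} (X : orderType d) (D : set (operation X)).
Hypotheses (hX : infinite_regular_cardinal X) (hD : is_clone D).
Hypothesis hU : almost_unary_clone X `<=` D.

(** Cutting [p] off at [G] of one extra variable gives an almost unary [P]; substituting [h] for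
    that variable returns [p]. *)
Lemma clone_dominated (m : nat) (h p : op X m) (G : X -> X) :
  D (mkop h) -> (forall x, p x < G (h x)) -> D (mkop p).
Proof.
have [_ Dproj Dcomp] := hD => Dh pG.
have [S SP] := choice (exists_gt hX).
pose P (w : 'I_m.+1 -> X) := Order.min (p (fun i => w (lift ord0 i))) (G (w ord0)).
have DP : D (mkop P).
  by apply: hU; exists (S \o G), ord0 => w; rewrite /= gt_min SP orbT.
pose g (i : 'I_m.+1) : op X m := if unlift ord0 i is Some j then projection j else h.
have -> : p = compose P g.
  apply/funext => x; rewrite /compose /P /g unlift_none.
  rewrite (_ : (fun i => _) = x); last by apply/funext => i; rewrite liftK.
  by rewrite min_l // ltW.
by apply: Dcomp => // i; rewrite /g; case: unlift => [j|//]; exact: Dproj.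
Qed.

End AboveAlmostUnary.

(** * The second smallest entry of a tuple *)

Section SecondSmallest.
Local Open Scope order_scope.
Context {d : Order.disp_t} (X : orderType d).

Lemma exists_sorting_perm (n : nat) (x : 'I_n -> X) :
  exists s : {perm 'I_n}, forall a b : 'I_n, (a <= b)%N -> x (s a) <= x (s b).
Proof.
have /tuple_permP[s sP] : perm_eq (sort <=%O [tuple x i | i < n]) [tuple x i | i < n].
  by rewrite perm_sort.
exists s => a b leab.
have xs (c : 'I_n) : x (s c) = nth (x a) (sort <=%O [tuple x i | i < n]) c.
  by rewrite sP -tnth_nth !tnth_mktuple.
rewrite !xs; apply: sorted_leq_nth => //; rewrite ?sort_le_sorted //.
- exact: le_trans.
- by rewrite inE size_sort size_tuple.
- by rewrite inE size_sort size_tuple.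
Qed.

Context (n : nat) (n_ge2 : (2 <= n)%N).
Local Notation second := (Ordinal n_ge2).

Lemma second_smallest_le (y : 'I_n -> X) :
  exists j, forall l, l != j -> order_stat second y <= y l.
Proof.
have [s sP] := exists_sorting_perm y.
exists (s (Ordinal (ltnW n_ge2))) => l; rewrite (order_statE _ sP) -(permKV s l).
by rewrite (inj_eq perm_inj) -val_eqE /= -lt0n => l_gt0; exact: sP.
Qed.

(** Of the positions of the two smallest entries, at least one differs from [j]. *)
Lemma second_smallest_ge (y : 'I_n -> X) (j : 'I_n) :
  exists2 l, l != j & y l <= order_stat second y.
Proof.
have [s sP] := exists_sorting_perm y.
have [->|] := eqVneq j (s second).
  exists (s (Ordinal (ltnW n_ge2))); first by rewrite (inj_eq perm_inj).
  by rewrite (order_statE _ sP); exact: sP.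
by rewrite eq_sym; exists (s second) => //; rewrite (order_statE _ sP).
Qed.

End SecondSmallest.

(** * Sets of variables along which a function is unbounded *)

Section Unboundedness.
Local Open Scope order_scope.
Context {d : Order.disp_t} (X : orderType d).
Hypothesis hX : infinite_regular_cardinal X.

Definition unbounded_along (m : nat) (f : op X m) (B : {set 'I_m}) : Prop :=
  exists a, forall b, exists x : 'I_m -> X,
    (forall i, i \notin B -> x i <= a) /\ b <= f x.

Lemma not_unbounded_along (m : nat) (f : op X m) (B : {set 'I_m}) :
    ~ unbounded_along f B ->
  exists F : X -> X, forall a x, (forall i, i \notin B -> x i <= a) -> f x < F a.
Proof.
move=> /forallNP fB.
have [|F FP] := @choice X X
    (fun a b => forall x, (forall i, i \notin B -> x i <= a) -> f x < b); last by exists F.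
move=> a; have /existsNP[b bP] := fB a; exists b => x xa.
by rewrite ltNge; apply/negP => lebf; apply: bP; exists x.
Qed.

Lemma unbounded_along_neq0 (m : nat) (f : op X m) : ~ unbounded_along f finset.set0.
Proof.
move=> [a fP]; have [b bP] := box_bounded hX f a; have [x [xa]] := fP b.
by rewrite leNgt bP // => i; apply: xa; rewrite inE.
Qed.

(** The complement of the singleton of [i] misses [i], so [f] is not unbounded along it: a bound on
    [x i] alone bounds [f x]. *)
Lemma almost_unary_unbounded (m : nat) (f : op X m) (i : 'I_m) :
  (forall B, unbounded_along f B -> i \in B) -> almost_unary f.
Proof.
move=> fi; have [|F FP] := @not_unbounded_along m f (finset.setC (finset.set1 i)).
  by move=> /fi; rewrite !inE eqxx.
by exists F, i => x; apply: FP => j; rewrite !inE negbK => /eqP ->.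
Qed.

Context (n : nat) (n_ge2 : (2 <= n)%N) (D : set (operation X)).
Hypotheses (hD : is_clone D) (hU : almost_unary_clone X `<=` D).

Lemma second_smallest_generated (m : nat) (f : op X m) (B : 'I_n -> {set 'I_m}) :
    D (mkop f) -> (forall j, unbounded_along f (B j)) ->
    (forall i, exists j, i \notin B j) ->
  D (mkop (@order_stat d X n (Ordinal n_ge2))).
Proof.
have [_ _ Dcomp] := hD => Df fB Bcap.
set m2 := order_stat _.
have [jB jBP] := choice Bcap; have [a aP] := choice fB.
have [z zP] := choice (fun q : 'I_n * X => aP q.1 q.2).
have [J JP] := choice (@second_smallest_le d X n n_ge2).
(* All entries of [y] except possibly the one at [J y] are at least [m2 y]. The tuple
   [z (J y, m2 y)] drives [f] up to [m2 y], with coordinates outside [B (J y)] at most [a (J y)]. *)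
pose u i : op X n := fun y => z (J y, m2 y) i.
have [a' a'P] := finite_bounded hX a.
have [F FP] := finite_majorant hX (fun (q : 'I_n * 'I_m) v => z (q.1, v) q.2).
have [S SP] := choice (exists_gt hX).
have uU i : almost_unary (u i).
  (* If [jB i] is [J y], then [i] lies outside [B (J y)] and the constant [a'] bounds [u i y];
     otherwise [y (jB i)] is at least [m2 y] and [F] gives the bound. *)
  exists (fun v => Order.max a' (F v)), (jB i) => y; rewrite lt_max.
  have [eqJ|neqJ] := eqVneq (jB i) (J y).
    have [/= za _] := zP (J y, m2 y).
    by rewrite (le_lt_trans (za i _) (a'P _)) // -eqJ.
  by apply/orP; right; apply: (FP _ (J y, i)); exact: JP.
apply: (@clone_dominated d X D hX hD hU n (compose f u) m2 S).
  by apply: Dcomp => // i; apply: hU; exact: uU.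
by move=> y; have [_ le_m2] := zP (J y, m2 y); exact: le_lt_trans (SP _).
Qed.

Hypothesis hm2 : D (mkop (@order_stat d X n (Ordinal n_ge2))).

(* The inductive step is the Baker-Pixley argument: given n distinct members
   B_j of S and functions q_j adequate for S minus B_j, each member of S is
   served by all q_j but at most one, hence by the second smallest of them. *)
Lemma exists_dominating (m : nat) (S : {set {set 'I_m}}) :
    (forall k (B : 'I_k -> {set 'I_m}), (k < n)%N -> (forall j, B j \in S) ->
      exists i, forall j, i \in B j) ->
  exists q : op X m, D (mkop q) /\
    forall x B, B \in S -> exists2 i, i \in B & x i <= q x.
Proof.
have [_ Dproj Dcomp] := hD.
have [N] := ubnP #|S|; elim: N S => // N IHN S ltSN Scap.
have [ltSn|lenS] := ltnP #|S| n.
  (* Fewer than [n] sets share an element [i], and the projection to [i] serves as [q]. *)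
  have [i iP] := Scap #|S| enum_val ltSn (@enum_valP _ _).
  exists (fun x => x i); split=> [|x B BS]; first exact: Dproj.
  by exists i => //; have := iP (enum_rank_in BS B); rewrite enum_rankK_in.
pose B (j : 'I_n) := enum_val (widen_ord lenS j).
have BS j : B j \in S := enum_valP _.
have /choice[q /all_and2[Dq qP]] (j : 'I_n) : exists q : op X m, D (mkop q) /\
    forall x A, A \in finset.setD S (finset.set1 (B j)) -> exists2 i, i \in A & x i <= q x.
  apply: IHN => [|k A ltkn AS].
    have := cardsD1 (B j) S; rewrite BS add1n => cardS.
    by rewrite cardS ltnS in ltSN.
  by apply: Scap => // l; have := AS l; rewrite !inE => /andP[].
exists (compose (@order_stat d X n (Ordinal n_ge2)) q); split=> [|x A AS]; first exact: Dcomp.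
have [j ABj] : exists j, forall l, l != j -> A != B l.
  have [[j ABj]|AB] := pselect (exists j, A = B j).
    exists j => l; apply: contraNneq; rewrite ABj.
    by move=> /enum_val_inj /(congr1 val) /= /val_inj ->.
  by exists (Ordinal (ltnW n_ge2)) => l _; apply/eqP => ABl; apply: AB; exists l.
have [l nlj leq] := second_smallest_ge n_ge2 (fun l => q l x) j.
have [|i iA lexq] := qP l x A; first by rewrite !inE ABj.
by exists i => //; exact: le_trans leq.
Qed.

Lemma generated_of_intersecting (m : nat) (f : op X m) :
    (forall k (B : 'I_k -> {set 'I_m}), (k < n)%N ->
      (forall j, unbounded_along f (B j)) -> exists i, forall j, i \in B j) ->
  D (mkop f).
Proof.
move=> fcap.
pose S : {set {set 'I_m}} := finset (fun B => `[< unbounded_along f B >]).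
have [|q [Dq qS]] := @exists_dominating m S.
  by move=> k B ltkn BS; apply: fcap => // j; have := BS j; rewrite inE => /asboolP.
have [F FP] : {F : {set 'I_m} -> X -> X & forall B, ~ unbounded_along f B ->
    forall a x, (forall i, i \notin B -> x i <= a) -> f x < F B a}.
  apply: (@choice _ _ (fun B F => ~ unbounded_along f B ->
    forall a x, (forall i, i \notin B -> x i <= a) -> f x < F a)) => B.
  have [fB|/not_unbounded_along[F FP]] := pselect (unbounded_along f B); last by exists F.
  by exists id.
have [G GP] := choice (fun a => finite_bounded hX (F^~ a)).
apply: (@clone_dominated d X D hX hD hU m q f G) => // x.
(* Every set along which [f] is unbounded contains some [i] with [x i <= q x], hence is not [A]; so
   [F A (q x)] bounds [f x]. *)
pose A : {set 'I_m} := finset (fun i => ~~ (x i <= q x)).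
apply: lt_trans (GP (q x) A); apply: FP => [fA|i]; last by rewrite inE negbK.
have [|i] := qS x A; first by rewrite inE; exact/asboolP.
by rewrite inE => /negP.
Qed.

End Unboundedness.

Theorem theorem41 (d : Order.disp_t) (X : orderType d)
    (hX : infinite_regular_cardinal X)
    (C : set (operation X)) (hC : is_clone C)
    (hUC : almost_unary_clone X `<` C) :
  exists (n : nat) (n_ge2 : (2 <= n)%N), C = clone_M X n_ge2.
Proof.
have [Cpos _ _] := hC; move: hUC => [UC /nonsubset[[m0 f0] [Cf0 Uf0]]].
pose nonintersecting (k : nat) : Prop := exists m (f : op X m) (B : 'I_k -> {set 'I_m}),
  [/\ C (mkop f), forall j, unbounded_along f (B j)
    & forall i, exists j, i \notin B j].
have /ex_minnP[n /asboolP[m [f [B [Cf fB Bcap]]]] nmin] :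
    exists k, `[< nonintersecting k >].
  (* As [f0] is not almost unary, each variable [i] is avoided by some set along which [f0] is
     unbounded; these [m0] sets have empty intersection. *)
  exists m0; apply/asboolP; exists m0, f0.
  have /choice[B BP] (i : 'I_m0) : exists B, unbounded_along f0 B /\ i \notin B.
    apply: contrapT => /forallNP Bi; apply: Uf0.
    apply: (@almost_unary_unbounded _ _ _ _ i) => B fB.
    by apply: contrapT => /negP iB; apply: (Bi B).
  by exists B; split=> // [j|i]; [case: (BP j)|exists i; case: (BP i)].
(* An empty family omits no variable, and a single set omitting every variable is empty, along which
   nothing is unbounded. *)
have n_ge2 : (2 <= n)%N.
  case: n B fB Bcap {nmin} => [|[|//]] B fB Bcap.
    by have [[]] := Bcap (Ordinal (Cpos _ _ Cf)).
  have B0 : B ord0 = finset.set0.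
    by apply/setP => i; have [j] := Bcap i; rewrite inE ord1 => /negPf.
  by case: (@unbounded_along_neq0 _ _ hX m f); rewrite -B0.
exists n, n_ge2; apply/seteqP; split=> [[p g] Cg|]; last first.
  apply: smallest_sub => // _ [->|[g Ug <-]]; last exact: UC.
  exact: (second_smallest_generated hX n_ge2 hC UC Cf fB Bcap).
move=> D [hD]; rewrite subUset => -[hm2 hT].
have UD := almost_unary_generated hX hD hT.
apply: (generated_of_intersecting hX hD UD (hm2 _ erefl)) => k A ltkn gA.
(* Since [g] is in [C], fewer than [n] such sets without a common element would contradict the
   minimality of [n]. *)
apply: contrapT => /forallNP Acap.
suff : (n <= k)%N by rewrite leqNgt ltkn.
apply: nmin; apply/asboolP; exists p, g, A; split=> // i.
by have /existsNP[j /negP] := Acap i; exists j.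
Qed.
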